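(* Let $X$ be a compact manifold with boundary with a scattering metric $g$, $V\in x^2C^\infty(X)$ real, and $H=\Delta+V$, with scattering matrix $S(\lambda)$, $\lambda>0$. If the operator $S$ is defined by $$(Sf)(y,\lambda)=(S(\lambda)f(\cdot,\lambda))(y),\qquad y\in\partial X,\ \lambda\in\mathbb R^+,$$ then $$S=P_-^*P_+$$ as operators on $L^2(\partial X\times\mathbb R^+)$.
   Context: A scattering metric $g$ on a compact manifold with boundary $X$ of dimension $n$ is a Riemannian metric in the interior which near $\partial X$ has the form $g=\frac{dx^2}{x^4}+\frac{h'}{x^2}$ for some boundary defining function $x$ (fixed) and some smooth symmetric 2-cotensor $h'$ restricting to a metric $h$ on $\partial X$. $\Delta\ge0$ is the Laplacian of $g$. $\dot C^\infty(X)$ is the space of smooth functions vanishing with all derivatives at $\partial X$, $C^{-\infty}(X)$ its dual. For $\lambda\in\mathbb R\setminus\{0\}$ and $a\in C^\infty(\partial X)$ there is a unique $u\in C^{-\infty}(X)$ with $(H-\lambda^2)u=0$ of the form $u=e^{-i\lambda/x}x^{(n-1)/2}v_-+e^{i\lambda/x}x^{(n-1)/2}v_+$, $v_\pm\in C^\infty(X)$, $v_-|_{\partial X}=a$. The Poisson operator is $P(\lambda)a=u$, and the scattering matrix is $S(\lambda)a=v_+|_{\partial X}$. $H_{ac}(H)$ is the absolutely continuous spectral subspace of $H$. $P^*_\pm:H_{ac}(H)\to L^2(\partial X\times\mathbb R^+;dh\,d\lambda)$ is the unitary extension of $(P^*_\pm u)(y,\lambda)=(2\pi)^{-1/2}(P(\pm\lambda)^*u)(y)$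 (where $P(\lambda)^*$ is the adjoint with respect to $dg$ and $dh$), and $P_\pm$ is its adjoint, $P_\pm f=(2\pi)^{-1/2}\int_0^\infty P(\pm\lambda)(f(\cdot,\lambda))\,d\lambda$. $S$ is defined by the displayed formula on smooth functions and extended by continuity to $L^2$. *)

(* Defs.v *)
From HB Require Import structures.
From mathcomp Require Import all_boot all_order all_algebra.
From mathcomp Require Import complex.
From mathcomp Require Import all_classical all_reals all_analysis.

Set Implicit Arguments.
Unset Strict Implicit.
Unset Printing Implicit Defensive.

Import Order.TTheory GRing.Theory Num.Theory.
Import numFieldNormedType.Exports.

Local Open Scope classical_set_scope.
Local Open Scope ring_scope.

Section Euclidean.
Context {R : realType} {m : nat}.
Implicit Types (f F : 'rV[R]_m.+1 -> R) (U A : set 'rV[R]_m.+1).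

Definition pderiv (j : 'I_m.+1) f : 'rV[R]_m.+1 -> R :=
  fun z => 'D_(delta_mx 0 j) f z.

Definition pderivs (s : seq 'I_m.+1) f : 'rV[R]_m.+1 -> R := foldr pderiv f s.

(* U is meant to be open. *)
Definition Cinfty U F : Prop :=
  forall s j z, U z ->
    {for z, continuous (pderivs s F)} /\
    derivable (pderivs s F) z (delta_mx 0 j).

Definition local_ext A f (z : 'rV[R]_m.+1) U F : Prop :=
  [/\ open U, U z, Cinfty U F & forall w, A w -> U w -> F w = f w].

(* Smoothness on an arbitrary set: f is locally the restriction of a smooth
   function on an open subset of R^n.  On relatively open subsets of the
   half-space this is smoothness up to the boundary; on relatively open
   subsets of the hyperplane it is ordinary smoothness in R^m. *)
Definition smooth_on A f : Prop :=
  forall z, A z -> exists U F, local_ext A f z U F.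

Definition lastc (z : 'rV[R]_m.+1) : R := z 0 ord_max.

Definition initc (z : 'rV[R]_m.+1) : 'rV[R]_m :=
  \row_a z 0 (lift ord_max a).

End Euclidean.

Definition snoc (R : realType) (m : nat) (y : 'rV[R]_m) (t : R) :
    'rV[R]_m.+1 :=
  \row_j (if unlift ord_max j is Some a then y 0 a else t).

(* Lebesgue integral over R^n of a nonnegative function, as an iterated
   one-dimensional integral (Tonelli); for n = 0 it is evaluation at the
   point. *)
Fixpoint iterint (R : realType) (n : nat) :
    ('rV[R]_n -> \bar R) -> \bar R :=
  match n with
  | 0%N => fun F => F 0
  | n'.+1 => fun F =>
      (\int[@lebesgue_measure R]_(t in setT)
         iterint (fun y : 'rV[R]_n' => F (snoc y t)))%E
  end.

Record manifold (R : realType) (m : nat) (X : ptopologicalType) := Manifold {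
  chart : Type;
  dom : chart -> set X;
  phi : chart -> X -> 'rV[R]_m.+1;
  psi : chart -> 'rV[R]_m.+1 -> X;
  chart_at : X -> chart;
  mf_compact : compact [set: X];
  mf_hausdorff : hausdorff_space X;
  dom_open : forall i, open (dom i);
  dom_chart_at : forall p, dom (chart_at p) p;
  phiK : forall i p, dom i p -> psi i (phi i p) = p;
  phi_continuous : forall i, {within dom i, continuous (phi i)};
  psi_continuous : forall i, {within phi i @` dom i, continuous (psi i)};
  phi_image : forall i, exists U : set 'rV[R]_m.+1,
    open U /\ phi i @` dom i = U `&` [set z | 0 <= lastc z];
  transition_smooth : forall i j k,
    smooth_on (phi i @` (dom i `&` dom j)) (fun z => phi j (psi i z) 0 k)
}.

Arguments chart {R m X} _.
Arguments dom {R m X} _ _ _.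
Arguments phi {R m X} _ _ _.
Arguments psi {R m X} _ _ _.
Arguments chart_at {R m X} _ _.

Section Manifold.
Context {R : realType} {m : nat} {X : ptopologicalType} (M : manifold R m X).
Local Notation C := R[i].

Definition bdry : set X :=
  [set p | exists i, dom M i p /\ lastc (phi M i p) = 0].

Definition inter : set X := ~` bdry.

Definition coords (i : chart M) (A : set X) : set 'rV[R]_m.+1 :=
  phi M i @` (dom M i `&` A).

Definition smooth_along (A : set X) (f : X -> R) : Prop :=
  forall i, smooth_on (coords i A) (f \o psi M i).

Definition csmooth_along (A : set X) (f : X -> C) : Prop :=
  smooth_along A (fun p => complex.Re (f p)) /\
  smooth_along A (fun p => complex.Im (f p)).

Definition flat (f : X -> R) : Prop :=
  forall i z, coords i bdry z ->
  forall U F, local_ext (coords i setT) (f \o psi M i) z U F ->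
  forall s, pderivs s F z = 0.

(* The space of smooth functions vanishing with all derivatives at the
   boundary. *)
Definition Cdot (u : X -> C) : Prop :=
  [/\ csmooth_along setT u, flat (fun p => complex.Re (u p)) &
      flat (fun p => complex.Im (u p))].

Definition boundary_defining (x : X -> R) : Prop :=
  [/\ smooth_along setT x,
      forall p, 0 <= x p,
      forall p, x p = 0 <-> bdry p &
      forall i z, coords i bdry z ->
        exists U F, local_ext (coords i setT) (x \o psi M i) z U F /\
          exists j, pderiv j F z != 0].

(* Component matrices in each chart. *)
Definition cotensor2 := chart M -> 'rV[R]_m.+1 -> 'M[R]_m.+1.

(* Jacobian of the change of coordinates from chart i to chart j, acting on
   row vectors. *)
Definition transition_jac (i j : chart M) (z : 'rV[R]_m.+1) : 'M[R]_m.+1 :=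
  \matrix_(a, b) pderiv a (fun w => phi M j (psi M i w) 0 b) z.

(* The transformation law is imposed at interior points only; at boundary
   points it follows by continuity. *)
Definition smooth_sym_cotensor (A : set X) (t : cotensor2) : Prop :=
  [/\ forall i a b, smooth_on (coords i A) (fun z => t i z a b),
      forall i z, coords i A z -> (t i z)^T = t i z &
      forall i j z, coords i (A `&` dom M j `&` inter) z ->
        t i z = transition_jac i j z *m t j (phi M j (psi M i z))
                  *m (transition_jac i j z)^T].

Definition quad n (T : 'M[R]_n) (v : 'rV[R]_n) : R := (v *m T *m v^T) 0 0.

Definition dcoord (f : X -> R) (i : chart M) (z : 'rV[R]_m.+1) : 'rV[R]_m.+1 :=
  \row_a pderiv a (f \o psi M i) z.

Definition riemannian_metric_inter (g : cotensor2) : Prop :=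
  smooth_sym_cotensor inter g /\
  forall i z v, coords i inter z -> v != 0 -> 0 < quad (g i z) v.

(* g = dx^2 / x^4 + h' / x^2 on a neighbourhood W of the boundary, with h'
   positive definite on vectors tangent to the boundary. *)
Definition scattering_metric (x : X -> R) (g h' : cotensor2) : Prop :=
  riemannian_metric_inter g /\
  exists W : set X,
    [/\ open W, bdry `<=` W, smooth_sym_cotensor W h',
        forall i z, coords i (W `&` inter) z ->
          let r := x (psi M i z) in
          g i z = r ^- 4 *: ((dcoord x i z)^T *m dcoord x i z)
                  + r ^- 2 *: h' i z &
        forall i z v, coords i bdry z -> v != 0 -> lastc v = 0 ->
          0 < quad (h' i z) v].

Definition bdry_metric (h' : cotensor2) (i : chart M) (y : 'rV[R]_m) : 'M[R]_m :=
  \matrix_(a, b) h' i (snoc y 0) (lift ord_max a) (lift ord_max b).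

Local Notation borelX := (g_sigma_algebraType (@open X)).

Definition volume_measure (g : cotensor2)
    (dg : {measure set borelX -> \bar R}) : Prop :=
  forall i (A : set borelX), measurable A -> A `<=` dom M i ->
    dg A = iterint (fun z =>
      (\1_(coords i (A `&` inter)) z * Num.sqrt (\det (g i z)))%:E).

(* The Riemannian measure dh of the boundary, as a measure on X carried by
   the boundary. *)
Definition bdry_measure (h' : cotensor2)
    (dh : {finite_measure set borelX -> \bar R}) : Prop :=
  forall i (A : set borelX), measurable A -> A `<=` dom M i ->
    dh A = iterint (fun y =>
      (\1_(coords i (A `&` bdry)) (snoc y 0)
         * Num.sqrt (\det (bdry_metric h' i y)))%:E).

Definition lap_chart (G : 'rV[R]_m.+1 -> 'M[R]_m.+1) (f : 'rV[R]_m.+1 -> R)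
    (z : 'rV[R]_m.+1) : R :=
  - (Num.sqrt (\det (G z)))^-1 *
    \sum_a pderiv a (fun w => Num.sqrt (\det (G w)) *
                       \sum_b invmx (G w) a b * pderiv b f w) z.

(* Nonnegative Laplacian; its value at interior points does not depend on the
   chart. *)
Definition laplacian (g : cotensor2) (f : X -> R) (p : X) : R :=
  let i := chart_at M p in lap_chart (g i) (f \o psi M i) (phi M i p).

Definition hamiltonian (g : cotensor2) (V : X -> R) (u : X -> C) : X -> C :=
  fun p =>
    ((laplacian g (fun q => complex.Re (u q)) p + V p * complex.Re (u p))
     +i* (laplacian g (fun q => complex.Im (u q)) p + V p * complex.Im (u p)))%C.

Definition in_x2Cinfty (x V : X -> R) : Prop :=
  exists W, smooth_along setT W /\ forall p, V p = x p ^+ 2 * W p.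

End Manifold.

Arguments bdry {R m X} M _.
Arguments inter {R m X} M _.

Notation borel X := (g_sigma_algebraType (@open X)).

Section L2.
Context {R : realType} {d : measure_display} {T : measurableType d}.
Context (mu : {measure set T -> \bar R}) (D : set T).
Implicit Types f g : T -> R[i].

Definition cintegral f : R[i] :=
  (Rintegral mu D (fun x => complex.Re (f x))
   +i* Rintegral mu D (fun x => complex.Im (f x)))%C.

Definition normsq (z : R[i]) : R := complex.Re z ^+ 2 + complex.Im z ^+ 2.

Definition L2 f : Prop :=
  [/\ measurable_fun D (fun x => complex.Re (f x)),
      measurable_fun D (fun x => complex.Im (f x)) &
      (\int[mu]_(x in D) (normsq (f x))%:E < +oo)%E].

Definition inner f g : R[i] := cintegral (fun x => f x * conjc (g x)).

Definition distsq f g : \bar R :=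
  (\int[mu]_(x in D) (normsq (f x - g x))%:E)%E.

Definition ae_eqon f g : Prop := {ae mu, forall x, D x -> f x = g x}.

End L2.

Section Operators.
Context {R : realType} {d1 d2 : measure_display}.
Context {T1 : measurableType d1} {T2 : measurableType d2}.
Context (mu1 : {measure set T1 -> \bar R}) (D1 : set T1).
Context (mu2 : {measure set T2 -> \bar R}) (D2 : set T2).
Implicit Types (K : set (T1 -> R[i])) (U : (T1 -> R[i]) -> (T2 -> R[i])).

(* T : K -> L^2(D2) is the extension by continuity of T0 from K0 `&` K to K:
   T agrees with T0 there, and every T u, u in K, is a limit of values T0 v
   (almost everywhere equal to T v) along v in K0 `&` K tending to u. *)
Definition ext_by_continuity K (K0 : set (T1 -> R[i])) T0 T : Prop :=
  [/\ forall u, K u -> L2 mu2 D2 (T u),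
      forall u, K0 u -> K u -> ae_eqon mu2 D2 (T u) (T0 u) &
      forall u (e : R), K u -> 0 < e ->
        exists v, [/\ K0 v, K v, (distsq mu1 D1 v u < e%:E)%E &
                      (distsq mu2 D2 (T v) (T u) < e%:E)%E]].

(* U is unitary from K, with the inner product of L^2(D1), onto L^2(D2). *)
Definition unitary_onto_L2 K U : Prop :=
  [/\ forall u, K u -> L2 mu2 D2 (U u),
      forall (c : R[i]) u v, K u -> K v ->
        ae_eqon mu2 D2 (U (fun p => c * u p + v p))
                       (fun q => c * U u q + U v q),
      forall u v, K u -> K v -> inner mu2 D2 (U u) (U v) = inner mu1 D1 u v &
      forall f, L2 mu2 D2 f -> exists u, K u /\ ae_eqon mu2 D2 (U u) f].

Definition adjoint_into K U (Ua : (T2 -> R[i]) -> (T1 -> R[i])) : Prop :=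
  forall f, L2 mu2 D2 f ->
    K (Ua f) /\
    forall u, K u -> inner mu1 D1 (Ua f) u = inner mu2 D2 f (U u).

End Operators.

Section Spectral.
Context {R : realType} {d : measure_display} {T : measurableType d}.
Context (mu : {measure set T -> \bar R}) (D : set T).
Local Notation fn := (T -> R[i]).

(* E is the projection-valued spectral measure of the self-adjoint operator
   with graph Hg: nu is the measure B |-> <E B u, u>, the domain is
   { u | \int t^2 d nu < oo }, and <H u, u> = \int t d nu. *)
Definition spectral_resolution (Hg : fn -> fn -> Prop)
    (E : set (measurableTypeR R) -> fn -> fn) : Prop :=
  [/\ forall B u, measurable B -> L2 mu D u -> L2 mu D (E B u),
      forall B u v, measurable B -> L2 mu D u -> L2 mu D v ->
        inner mu D (E B u) v = inner mu D u (E B v),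
      forall A B u, measurable A -> measurable B -> L2 mu D u ->
        ae_eqon mu D (E (A `&` B) u) (E A (E B u)),
      forall u, L2 mu D u -> ae_eqon mu D (E setT u) u &
      forall u, L2 mu D u ->
        exists nu : {finite_measure set (measurableTypeR R) -> \bar R},
        [/\ forall B, measurable B ->
              inner mu D (E B u) u = (fine (nu B) +i* 0)%C,
            (exists f, Hg u f) <-> (\int[nu]_(t in setT) (t ^+ 2)%:E < +oo)%E &
            forall f, Hg u f ->
              inner mu D f u = (Rintegral nu setT (fun t => t) +i* 0)%C]].

Definition ac_subspace (E : set (measurableTypeR R) -> fn -> fn) : set fn :=
  [set u | L2 mu D u /\
    forall B, measurable B -> lebesgue_measure B = 0%E ->
      inner mu D (E B u) u = 0].

End Spectral.

Section Scattering.
Context {R : realType} {m : nat} {X : ptopologicalType} (M : manifold R m X).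
Local Notation C := R[i].
Context (x : X -> R) (g : cotensor2 M) (V : X -> R).
Context (dg : {measure set (borel X) -> \bar R}).
Context (dh : {finite_measure set (borel X) -> \bar R}).

(* L^2(X, dg) is L2 dg (inter M), L^2 of the boundary is L2 dh (bdry M), and a
   function on the boundary is given by a function on X, used only through its
   values at boundary points. *)

(* The self-adjoint operator H on L^2(X, dg): closure of Delta + V. *)
Definition H_graph (u f : X -> C) : Prop :=
  [/\ L2 dg (inter M) u, L2 dg (inter M) f &
      forall e : R, 0 < e ->
        exists w, [/\ Cdot M w, (distsq dg (inter M) w u < e%:E)%E &
          (distsq dg (inter M) (hamiltonian g V w) f < e%:E)%E]].

(* (H - lambda^2) u = 0 in the dual of Cdot; u is identified with the
   functional w |-> \int u w dg. *)
Definition distrib_eigen (lam : R) (u : X -> C) : Prop :=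
  forall w, Cdot M w ->
    cintegral dg (inter M)
      (fun p => u p * (hamiltonian g V w p - (lam ^+ 2 +i* 0)%C * w p)) = 0.

Definition cis (t : R) : C := (cos t +i* sin t)%C.

(* u is a generalized eigenfunction with coefficients vm, vp; note that
   (n - 1) / 2 = m / 2. *)
Definition gen_eigen (lam : R) (u vm vp : X -> C) : Prop :=
  [/\ csmooth_along M setT vm, csmooth_along M setT vp,
      distrib_eigen lam u &
      forall p, inter M p ->
        let r := ((x p `^ (m%:R / 2)) +i* 0)%C in
        u p = cis (- (lam / x p)) * r * vm p + cis (lam / x p) * r * vp p].

Definition solves (lam : R) (a u : X -> C) : Prop :=
  exists vm vp, gen_eigen lam u vm vp /\ forall p, bdry M p -> vm p = a p.

(* P lam a is the unique u (uniqueness as a distribution on X, that is, on the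
   interior). *)
Definition poisson_operator (P : R -> (X -> C) -> (X -> C)) : Prop :=
  forall lam a, lam != 0 -> csmooth_along M (bdry M) a ->
    solves lam a (P lam a) /\
    forall u, solves lam a u -> forall p, inter M p -> u p = P lam a p.

Definition scattering_matrix (P S : R -> (X -> C) -> (X -> C)) : Prop :=
  forall lam a, lam != 0 -> csmooth_along M (bdry M) a ->
    exists vm vp, [/\ gen_eigen lam (P lam a) vm vp,
      forall p, bdry M p -> vm p = a p &
      forall p, bdry M p -> vp p = S lam a p].

(* Pa lam : Cdot -> C^oo of the boundary is the adjoint of P lam with respect
   to dg and dh. *)
Definition poisson_adjoint (P Pa : R -> (X -> C) -> (X -> C)) : Prop :=
  forall lam w, lam != 0 -> Cdot M w ->
    csmooth_along M (bdry M) (Pa lam w) /\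
    forall a, csmooth_along M (bdry M) a ->
      inner dg (inter M) (P lam a) w = inner dh (bdry M) a (Pa lam w).

Definition bdryR : set (borel X * measurableTypeR R) :=
  [set q | bdry M q.1 /\ 0 < q.2].

Definition dhdlam := (dh \x (@lebesgue_measure R))%E.

(* Smooth compactly supported functions on dX x R^+; in a chart the
   coordinates are (y, lambda). *)
Definition test_bdryR (f : borel X * measurableTypeR R -> C) : Prop :=
  let sm (k : C -> R) := forall i : chart M,
    smooth_on [set z | coords i (bdry M) (snoc (initc z) 0) /\ 0 < lastc z]
      (fun z => k (f (psi M i (snoc (initc z) 0), lastc z))) in
  [/\ L2 dhdlam bdryR f, sm (@complex.Re R), sm (@complex.Im R) &
      exists a b : R, 0 < a /\
        forall p lam, bdry M p -> ~ (a <= lam <= b) -> f (p, lam) = 0].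

Definition fiberwise (S : R -> (X -> C) -> (X -> C))
    (f : borel X * measurableTypeR R -> C) : borel X * measurableTypeR R -> C :=
  fun q => S q.2 (fun p => f (p, q.2)) q.1.

Definition scattering_operator (S : R -> (X -> C) -> (X -> C))
    (SS : (borel X * measurableTypeR R -> C) ->
          (borel X * measurableTypeR R -> C)) : Prop :=
  ext_by_continuity dhdlam bdryR dhdlam bdryR
    (L2 dhdlam bdryR) test_bdryR (fiberwise S) SS.

(* The map P^*_+ (sg = 1) or P^*_- (sg = -1): the unitary extension to the
   absolutely continuous subspace of
   u |-> (2 pi)^(-1/2) (P(sg lambda)^* u)(y). *)
Definition spectral_transform (sg : R)
    (E : set (measurableTypeR R) -> (borel X -> C) -> (borel X -> C))
    (Pa : R -> (X -> C) -> (X -> C))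
    (Q : (borel X -> C) -> (borel X * measurableTypeR R -> C)) : Prop :=
  unitary_onto_L2 dg (inter M) dhdlam bdryR (ac_subspace dg (inter M) E) Q /\
  ext_by_continuity dg (inter M) dhdlam bdryR
    (ac_subspace dg (inter M) E) (Cdot M)
    (fun u q => ((Num.sqrt (2 * pi))^-1 +i* 0)%C * Pa (sg * q.2) u q.1) Q.

End Scattering.

(* Main.v *)
(* The asymptotic expansion of [u = P(lambda) a] is also an expansion at energy
   parameter [- lambda], with the roles of [v_-] and [v_+] exchanged; uniqueness
   then gives [P(lambda) = P(-lambda) S(lambda)].  Dualizing and integrating over
   lambda, [<S f, P_-^* u> = <f, P_+^* u> = <P_+ f, u> = <P_-^* P_+ f, P_-^* u>],
   and [P_-^*] is onto.  The first equality is checked for test functions [f] and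
   [u] in [Cdot], and extended by density since [P_+^*] and [P_-^*] are isometric.
   Real parts of the inner products suffice, because a function orthogonal to
   itself in this sense vanishes. *)
Require Import Defs.
From HB Require Import structures.
From mathcomp Require Import all_boot all_order all_algebra.
From mathcomp Require Import complex.
From mathcomp Require Import all_classical all_reals all_analysis.
From mathcomp Require Import measurable_realfun ring lra.
Import Order.TTheory GRing.Theory Num.Theory.
Import numFieldNormedType.Exports.
Local Open Scope classical_set_scope.
Local Open Scope ring_scope.

Set Implicit Arguments.
Unset Strict Implicit.
Unset Printing Implicit Defensive.

(** * The real part of the [L^2] inner product as a real scalar product *)

Section RealInner.
Context {R : realType} {d : measure_display} {T : measurableType d}.
Context (mu : {measure set T -> \bar R}) (D : set T) (mD : measurable D).
Implicit Types f g h : T -> R[i].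

Definition rdot (z w : R[i]) : R :=
  complex.Re z * complex.Re w + complex.Im z * complex.Im w.

Definition rinner f g : R := complex.Re (inner mu D f g).

Lemma Re_mul_conjc (z w : R[i]) : complex.Re (z * conjc w) = rdot z w.
Proof. by case: z w => a b [c e]; rewrite /rdot /=; ring. Qed.

Lemma normsqE (z : R[i]) : normsq z = rdot z z.
Proof. by rewrite /normsq /rdot !expr2. Qed.

Lemma rinnerE f g : rinner f g = Rintegral mu D (fun x => rdot (f x) (g x)).
Proof. by apply: eq_Rintegral => x _; exact: Re_mul_conjc. Qed.

Lemma rinnerC f g : rinner f g = rinner g f.
Proof.
by rewrite !rinnerE; apply: eq_Rintegral => x _; rewrite /rdot; ring.
Qed.

Lemma measurable_rdot f g : L2 mu D f -> L2 mu D g ->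
  measurable_fun D (fun x => rdot (f x) (g x)).
Proof.
by move=> [mf1 mf2 _] [mg1 mg2 _]; apply: measurable_funD; apply: measurable_funM.
Qed.

Lemma integrable_normsq f : L2 mu D f ->
  mu.-integrable D (EFin \o (fun x => normsq (f x))).
Proof.
move=> L2f; apply/integrableP; split.
  apply/measurable_EFinP; have := measurable_rdot L2f L2f.
  by apply: eq_measurable_fun => x _; rewrite normsqE.
have [_ _] := L2f; congr (_ < _)%E; apply: eq_integral => x _ /=.
by rewrite ger0_norm// /normsq addr_ge0// sqr_ge0.
Qed.

(** Pointwise, the product is dominated by [|f|^2 + |g|^2]; the sign of each square [(a + c)^2],
    [(a - c)^2] supplies the two bounds. *)
Lemma integrable_rdot f g : L2 mu D f -> L2 mu D g ->
  mu.-integrable D (EFin \o (fun x => rdot (f x) (g x))).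
Proof.
move=> L2f L2g.
have := integrableD mD (integrable_normsq L2f) (integrable_normsq L2g).
apply: le_integrable => //; first exact/measurable_EFinP/measurable_rdot.
move=> x _ /=; rewrite lee_fin [leRHS]ger0_norm; last first.
  by rewrite /normsq !addr_ge0 ?sqr_ge0.
rewrite ler_norml /normsq /rdot.
case: (f x) (g x) => a b [c e] /=.
have := (sqr_ge0 (a + c), sqr_ge0 (b + e), sqr_ge0 (a - c), sqr_ge0 (b - e)).
have := (sqr_ge0 a, sqr_ge0 b, sqr_ge0 c, sqr_ge0 e).
by move=> [[[? ?] ?] ?] [[[? ?] ?] ?]; apply/andP; split; nra.
Qed.

Lemma L2B f g : L2 mu D f -> L2 mu D g -> L2 mu D (fun x => f x - g x).
Proof.
move=> L2f L2g; have [mf1 mf2 _] := L2f; have [mg1 mg2 _] := L2g.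
have E1 : (fun x => complex.Re (f x - g x)) =
    (fun x => complex.Re (f x)) \- (fun x => complex.Re (g x)).
  by apply/funext => x /=; rewrite raddfB.
have E2 : (fun x => complex.Im (f x - g x)) =
    (fun x => complex.Im (f x)) \- (fun x => complex.Im (g x)).
  by apply/funext => x /=; rewrite raddfB.
have m1 : measurable_fun D (fun x => complex.Re (f x - g x)).
  by rewrite E1; exact: measurable_funB.
have m2 : measurable_fun D (fun x => complex.Im (f x - g x)).
  by rewrite E2; exact: measurable_funB.
split=> //.
have := integrableD mD (integrable_normsq L2f) (integrable_normsq L2g).
(* The factor 2 is that of [|z - w|^2 <= 2 (|z|^2 + |w|^2)]. *)
move=> /(integrableZl mD 2%R) /integrableP[mh].
apply: le_lt_trans; apply: ge0_le_integral => //.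
- by move=> x _; rewrite lee_fin addr_ge0 ?sqr_ge0.
- apply/measurable_EFinP; apply: measurable_funD.
    exact: (measurable_funX 2 m1).
  exact: (measurable_funX 2 m2).
- exact: measurableT_comp.
- move=> x _ /=; rewrite lee_fin /normsq !raddfB /=.
  case: (f x) (g x) => a b [c e] /=.
  by have := (sqr_ge0 (a + c), sqr_ge0 (b + e)) => -[? ?]; rewrite ger0_norm; nra.
Qed.

Lemma rinnerBl f g h : L2 mu D f -> L2 mu D g -> L2 mu D h ->
  rinner (fun x => f x - g x) h = rinner f h - rinner g h.
Proof.
move=> L2f L2g L2h; rewrite !rinnerE -RintegralB//; last 2 first.
- exact: integrable_rdot.
- exact: integrable_rdot.
by apply: eq_Rintegral => x _; rewrite /rdot !raddfB /=; ring.
Qed.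

Lemma rinnerBr f g h : L2 mu D f -> L2 mu D g -> L2 mu D h ->
  rinner h (fun x => f x - g x) = rinner h f - rinner h g.
Proof. by move=> *; rewrite rinnerC rinnerBl// !(rinnerC h). Qed.

Lemma integral_normsq f : L2 mu D f ->
  (\int[mu]_(x in D) (normsq (f x))%:E)%E = (rinner f f)%:E.
Proof.
move=> L2f; rewrite rinnerE /Rintegral fineK.
  by apply: eq_integral => x _; rewrite normsqE.
by apply: integrable_fin_num => //; exact: integrable_rdot.
Qed.

Lemma distsqE f g : L2 mu D f -> L2 mu D g ->
  distsq mu D f g = (rinner f f - 2 * rinner f g + rinner g g)%:E.
Proof.
move=> L2f L2g; rewrite /distsq.
rewrite (@integral_normsq (fun x => f x - g x)); last exact: L2B.
rewrite rinnerBl ?rinnerBr//; try exact: L2B.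
by rewrite (rinnerC g f); congr EFin; ring.
Qed.

(** Takes the place of Cauchy-Schwarz: the free weight [t] lets one term be made small at the
    expense of the other. The bound is twice the sharp one, which is harmless for continuity. *)
Lemma rinner_young f h (t : R) : L2 mu D f -> L2 mu D h -> 0 < t ->
  `|rinner f h| <= t * rinner f f + t^-1 * rinner h h.
Proof.
move=> L2f L2h t0; rewrite !rinnerE.
have i1 := integrable_rdot L2f L2f; have i2 := integrable_rdot L2h L2h.
have iZ (k : R) F : mu.-integrable D (EFin \o F) ->
    mu.-integrable D (EFin \o (fun x => k * F x)).
  by move=> /(integrableZl mD k).
rewrite -RintegralZl// -[X in _ + X]RintegralZl// -RintegralD//; try exact: iZ.
apply: le_trans (le_normr_Rintegral mD (integrable_rdot L2f L2h)) _.
apply: le_Rintegral => //.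
- exact: integrable_norm (integrable_rdot L2f L2h).
- by have := integrableD mD (iZ t _ i1) (iZ t^-1 _ i2).
move=> x _; rewrite /rdot.
case: (f x) (h x) => a b [c e] /=.
rewrite ler_norml; set s := t^-1; have s0 : 0 < s by rewrite invr_gt0.
have ts : t * s = 1 by rewrite divff// gt_eqF.
(* Completing the square, with [s] the inverse of [t]; the signs of [v] give both halves of the
   absolute value. *)
have sq (u v : R) : s * (t * u + v) ^+ 2 = t * u ^+ 2 + s * v ^+ 2 + 2 * (u * v).
  rewrite (_ : s * _ = (t * s) * (t * u ^+ 2) + s * v ^+ 2
    + 2 * (t * s) * (u * v)); last by ring.
  by rewrite ts; ring.
have p (u v : R) : 0 <= t * u ^+ 2 + s * v ^+ 2 + 2 * (u * v).
  rewrite -sq; apply: mulr_ge0; [exact: ltW|exact: sqr_ge0].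
have pn (u v : R) : 0 <= t * u ^+ 2 + s * v ^+ 2 - 2 * (u * v).
  by have := p u (- v); rewrite sqrrN !mulrN.
have [p1 p2] := (p a c, p b e); have [n1 n2] := (pn a c, pn b e).
have q (u v : R) : 0 <= t * u ^+ 2 + s * v ^+ 2.
  by apply: addr_ge0; apply: mulr_ge0; rewrite ?sqr_ge0 ?ltW.
have [q1 q2] := (q a c, q b e).
by apply/andP; split; lra.
Qed.

Lemma rinner_ge0 f : 0 <= rinner f f.
Proof.
rewrite rinnerE; apply: Rintegral_ge0 => x _.
by rewrite -normsqE addr_ge0 ?sqr_ge0.
Qed.

Lemma rinner_continuous f (e : R) : L2 mu D f -> 0 < e -> exists2 r : R, 0 < r &
  forall g h, L2 mu D g -> L2 mu D h -> (distsq mu D g h < r%:E)%E ->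
    `|rinner f g - rinner f h| < e.
Proof.
move=> L2f e0; have N0 := rinner_ge0 f; set N := rinner f f in N0 *.
(* This weight makes [t * N] at most [e / 2], with [N + 1] avoiding a division by zero when [N = 0];
   the radius [t * (e / 2)] then keeps the other term below [e / 2]. *)
pose t := e / (2 * (N + 1)); have t0 : 0 < t by rewrite divr_gt0// mulr_gt0// ltr_wpDl.
exists (t * (e / 2)) => [|g h L2g L2h dgh]; first by rewrite mulr_gt0// divr_gt0.
have L2gh := L2B L2g L2h; rewrite -rinnerBr//.
apply: le_lt_trans (rinner_young L2f L2gh t0) _.
move: dgh; rewrite /distsq (integral_normsq L2gh) lte_fin -(ltr_pdivrMl _ _ t0) => dgh.
have tN : t * N <= e / 2.
  have -> : t * N = e / 2 * (N / (N + 1)) by rewrite /t; field; lra.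
  by rewrite ler_piMr ?ler_pdivrMr ?mul1r; lra.
by apply: le_lt_trans (lerD tN (lexx _)) _; rewrite -/N; lra.
Qed.

Lemma rinner_ae_eql f g h : L2 mu D f -> L2 mu D g -> L2 mu D h ->
  ae_eqon mu D f g -> rinner f h = rinner g h.
Proof.
move=> L2f L2g L2h fg; rewrite !rinnerE /Rintegral; congr fine.
apply: ae_eq_integral => //; try exact/measurable_EFinP/measurable_rdot.
by apply: filterS fg => x + Dx => /(_ Dx) ->.
Qed.

Lemma rinner_ae_eqr f g h : L2 mu D f -> L2 mu D g -> L2 mu D h ->
  ae_eqon mu D f g -> rinner h f = rinner h g.
Proof. by move=> *; rewrite rinnerC (@rinner_ae_eql f g)// rinnerC. Qed.

(** A nonnegative function with zero integral vanishes almost everywhere; here it is [|f - g|^2]. *)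
Lemma rinner_definite f g : L2 mu D f -> L2 mu D g ->
  rinner (fun x => f x - g x) (fun x => f x - g x) = 0 -> ae_eqon mu D f g.
Proof.
move=> L2f L2g fg0; have L2h := L2B L2f L2g.
have := integral_normsq L2h; rewrite fg0 => h0.
have mh := measurable_int _ (integrable_normsq L2h).
have : ae_eq mu D (EFin \o (fun x => normsq (f x - g x))) (cst 0%E).
  apply/(ae_eq_integral_abs _ mD mh); apply: etrans h0.
  by apply: eq_integral => x _; rewrite gee0_abs// lee_fin addr_ge0 ?sqr_ge0.
apply: filterS => x /= + Dx => /(_ Dx) [].
move/eqP; rewrite /normsq paddr_eq0 ?sqr_ge0// !sqrf_eq0 !raddfB !subr_eq0.
by case: (f x) (g x) => a b [c e] /= /andP[/eqP-> /eqP->].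
Qed.

End RealInner.

(** * Smooth functions on Euclidean sets: translation and interior minima *)

Section Smooth.
Context {R : realType} {m : nat}.
Implicit Types (f F : 'rV[R]_m.+1 -> R) (U A B : set 'rV[R]_m.+1).

Lemma smooth_on_subset A B f : A `<=` B -> smooth_on B f -> smooth_on A f.
Proof.
move=> AB sf z Az; have [U [F [oU Uz cF Ff]]] := sf _ (AB _ Az).
by exists U, F; split=> // w /AB; exact: Ff.
Qed.

Lemma eq_smooth_on A f g : (forall z, A z -> f z = g z) ->
  smooth_on A f -> smooth_on A g.
Proof.
move=> fg sf z Az; have [U [F [oU Uz cF Ff]]] := sf _ Az.
by exists U, F; split=> // w Aw Uw; rewrite Ff// fg.
Qed.

Lemma deriveE_shift f (c z v : 'rV[R]_m.+1) :
  'D_v (fun w => f (w + c)) z = 'D_v f (z + c).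
Proof.
rewrite /derive.
rewrite (_ : (fun h : R => _) =
  fun h => h^-1 *: ((f \o shift (z + c)) (h *: v) - f (z + c))) //.
by apply/funext => h /=; rewrite addrA.
Qed.

Lemma derivable_shift f (c z v : 'rV[R]_m.+1) :
  derivable f (z + c) v -> derivable (fun w => f (w + c)) z v.
Proof.
move=> df; rewrite /derivable.
rewrite (_ : (fun h : R => _) =
  fun h => h^-1 *: ((f \o shift (z + c)) (h *: v) - f (z + c))) //.
by apply/funext => h /=; rewrite addrA.
Qed.

Lemma pderivs_shift s f (c : 'rV[R]_m.+1) :
  pderivs s (fun w => f (w + c)) = fun w => pderivs s f (w + c).
Proof.
elim: s => //= j s ->; apply/funext => z; rewrite /pderiv.
exact: (deriveE_shift (pderivs s f)).
Qed.

Lemma continuous_shift (c : 'rV[R]_m.+1) : continuous (fun w : 'rV[R]_m.+1 => w + c).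
Proof. by move=> z; exact: (cvgD (@cvg_id _ _) (cvg_cst c)). Qed.

(** Iterated partial derivatives commute with translations. This moves the slice at height [lambda]
    down to the boundary hyperplane. *)
Lemma Cinfty_shift U F (c : 'rV[R]_m.+1) :
  Cinfty U F -> Cinfty [set w | U (w + c)] (fun w => F (w + c)).
Proof.
move=> cF s j z Uz; have [cz dz] := cF s j _ Uz; rewrite pderivs_shift; split.
  exact: (cvg_comp (fun w => w + c) (pderivs s F) (@continuous_shift c z) cz).
exact: derivable_shift.
Qed.

(** Fermat's rule: the difference quotients are nonpositive from the left and nonnegative from the
    right, and both converge to the derivative. *)
Lemma derive_interior_min U F (z v : 'rV[R]_m.+1) : nbhs z U ->
  (forall w, U w -> F z <= F w) -> derivable F z v -> 'D_v F z = 0.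
Proof.
move=> Uz Fmin dF.
have Uline : \forall t \near (0 : R), U (t *: v + z).
  have : (fun t : R => t *: v + z) @ (0 : R) --> 0 *: v + z.
    exact: (cvgD (@scalel_continuous _ 'rV[R]_m.+1 v 0) (cvg_cst z)).
  by rewrite scale0r add0r => /(_ U Uz).
have left0 : (0 : R)^'- `=>` (0 : R)^'.
  by apply: within_subset => t /= t0; rewrite lt_eqF.
have right0 : (0 : R)^'+ `=>` (0 : R)^'.
  by apply: within_subset => t /= t0; rewrite gt_eqF.
have quot (F0 : set_system R) : ProperFilter F0 -> F0 `=>` (0 : R)^' ->
    (fun h => h^-1 *: ((F \o shift z) (h *: v) - F z)) @ F0 --> 'D_v F z.
  by move=> FF0 F00; apply: cvg_trans dF; apply: cvg_app.
apply/eqP; rewrite eq_le; apply/andP; split.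
  apply: (cvgr_to_le (quot _ _ left0)); near=> t.
  apply: mulr_le0_ge0; first by rewrite invr_le0 ltW.
  rewrite subr_ge0; apply: Fmin; near: t.
  by apply: cvg_within; exact: Uline.
apply: (cvgr_to_ge (quot _ _ right0)); near=> t.
apply: mulr_ge0; first by rewrite invr_ge0 ltW.
rewrite subr_ge0; apply: Fmin; near: t.
by apply: cvg_within; exact: Uline.
Unshelve. all: end_near. Qed.

End Smooth.

(** * Boundary and interior of the manifold, seen in charts *)

Section ManifoldBoundary.
Context {R : realType} {m : nat} {X : ptopologicalType} (M : manifold R m X).
Implicit Types (p q : X) (i : chart M).

Lemma lastc_continuous : continuous (@lastc R m).
Proof. exact: coord_continuous. Qed.

Lemma snocK (w : 'rV[R]_m.+1) : snoc (initc w) (lastc w) = w.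
Proof.
apply/rowP => j; rewrite !mxE; case: unliftP => [a ->|->] //.
by rewrite mxE.
Qed.

Lemma initc_vshift (w : 'rV[R]_m.+1) t : initc (w + snoc 0 t) = initc w.
Proof. by apply/rowP => a; rewrite !mxE liftK mxE addr0. Qed.

Lemma lastc_vshift (w : 'rV[R]_m.+1) t : lastc (w + snoc 0 t) = lastc w + t.
Proof. by rewrite /lastc !mxE unlift_none. Qed.

Lemma phi_continuous_at i p : dom M i p -> {for p, continuous (phi M i)}.
Proof.
move=> ip; have := @phi_continuous _ _ _ M i.
by rewrite (continuous_open_subspace _ (dom_open i)) => /(_ p (mem_set ip)).
Qed.

Lemma near_dom i p : dom M i p -> \near p, dom M i p.
Proof. by move=> ip; apply: open_nbhs_nbhs; split=> //; exact: dom_open. Qed.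

Lemma lastc_phi_ge0 i p : dom M i p -> 0 <= lastc (phi M i p).
Proof.
move=> ip; have [U [_ iU]] := @phi_image _ _ _ M i.
have : (phi M i @` dom M i) (phi M i p) by exists p.
by rewrite iU => -[].
Qed.

Context (x : X -> R) (hx : boundary_defining M x).

(* At a boundary point that some chart sends to the interior of the half-space,
   x would attain its minimum 0 at an interior point, so its differential there
   would vanish. *)
Lemma bdry_lastc i p : dom M i p -> bdry M p -> lastc (phi M i p) = 0.
Proof.
move=> ip bp; have [_ x0 xb xd] := hx.
have ci : coords i (bdry M) (phi M i p) by exists p.
have [U [F [[oU Uz cF Fx] [j]]]] := xd _ _ ci.
case: (ltrgtP (lastc (phi M i p)) 0) => [||//]; first by rewrite ltNge lastc_phi_ge0.
move=> z0 /eqP[]; have [U0 [oU0 iU0]] := @phi_image _ _ _ M i.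
have Fpsi w : U w -> U0 w -> 0 < lastc w -> F w = x (psi M i w).
  move=> Uw U0w w0; apply: Fx => //; rewrite /coords setIT iU0.
  by split=> //; exact: ltW.
have U0z : U0 (phi M i p).
  have : (phi M i @` dom M i) (phi M i p) by exists p.
  by rewrite iU0 => -[].
(* On this open set [F] is [x] read in the chart, hence nonnegative, and at the centre it is
   [x p = 0]. *)
apply: (@derive_interior_min _ _ (U `&` (U0 `&` [set w | 0 < lastc w]))).
- apply: open_nbhs_nbhs; split=> //; do 2 apply: openI => //.
  have := @open_comp _ _ (@lastc R m) [set t | 0 < t] _ (@open_gt _ 0).
  by apply => w _; exact: lastc_continuous.
- move=> w [Uw [U0w w0]]; rewrite !Fpsi// phiK//.
  by rewrite (xb p).2.
- by have [_] := cF [::] j _ Uz.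
Qed.

(** A point belongs to [bdry] as soon as one chart says so. By [bdry_lastc] the chart at [p] alone
    decides this for all nearby points, and there the last coordinate stays positive. *)
Lemma inter_open : open (inter M).
Proof.
rewrite openE => p ip; have dp := dom_chart_at M p.
set i := chart_at M p in dp.
have p0 : 0 < lastc (phi M i p).
  rewrite lt_def lastc_phi_ge0// andbT; apply/eqP => p0.
  by apply: ip; exists i.
have : \near p, 0 < lastc (phi M i p).
  have c : {for p, continuous (fun q => lastc (phi M i q))}.
    apply: cvg_comp; last exact: lastc_continuous.
    exact: phi_continuous_at.
  exact: (cvgr_gt _ c).
apply: filterS2 (near_dom dp) => q dq q0 bq.
by move: q0; rewrite bdry_lastc// ltxx.
Qed.

Lemma smooth_along_continuous (A : set X) (f : X -> R) :
  smooth_along M A f -> {within A, continuous f}.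
Proof.
move=> sf; apply/subspace_continuousP => p Ap.
have dp := dom_chart_at M p; set i := chart_at M p in dp.
have cz : coords i A (phi M i p) by exists p.
have [U [F [oU Uz cF Ff]]] := sf i _ cz.
have [cFz _] := cF [::] ord0 _ Uz.
have fp : F (phi M i p) = f p by rewrite Ff//= phiK.
have cFphi : F (phi M i q) @[q --> p] --> f p.
  by rewrite -fp; exact: cvg_comp (phi_continuous_at dp) cFz.
have nU : \near p, U (phi M i p).
  by apply: (phi_continuous_at dp); apply: open_nbhs_nbhs.
move=> O /cFphi; apply: filterS3 (near_dom dp) nU => q dq Uq OFq Aq.
have : O (F (phi M i q)) by [].
by rewrite Ff//= ?phiK//; exists q.
Qed.

End ManifoldBoundary.

(** Open intervals generate the Borel sets of the line, and their preimages are traces on [A] of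
    open sets of [X]. *)
Lemma continuous_within_measurable (R : realType) (X : ptopologicalType)
    (A : set (borel X)) (f : X -> R) :
  {within (A : set X), continuous f} -> measurable_fun A (f : borel X -> R).
Proof.
move=> cf mA; apply: (measurability _ (RGenOpens.measurableE R)) => //.
move=> _ [_ [a [b ->] <-]].
have oab : open (`]a, b[%classic : set R) by exact: interval_open.
have /open_subspaceP[V oV VA] := iffLR (continuousP _) cf _ oab.
have -> : A `&` f @^-1` `]a, b[%classic = V `&` A by rewrite VA setIC.
by apply: measurableI => //; exact: sub_sigma_algebra.
Qed.

(** * Measurability and smoothness of data on the boundary *)

Section BoundaryData.
Context {R : realType} {m : nat} {X : ptopologicalType} (M : manifold R m X).
Context (x : X -> R) (hx : boundary_defining M x).

Lemma measurable_inter : measurable (inter M : set (borel X)).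
Proof. by apply: sub_sigma_algebra; exact: inter_open hx. Qed.

Lemma measurable_bdry : measurable (bdry M : set (borel X)).
Proof. by rewrite -[bdry M]setCK; apply: measurableC; exact: measurable_inter. Qed.

Lemma measurable_bdryR : measurable (bdryR M).
Proof.
rewrite (_ : bdryR M = bdry M `*` `]0, +oo[%classic).
  by apply: measurableX; [exact: measurable_bdry|exact: measurable_itv].
by apply/seteqP; split=> -[p l] [] /=; rewrite in_itv/= andbT.
Qed.

Lemma csmooth_bdry_measurable (a : X -> R[i]) : csmooth_along M (bdry M) a ->
  measurable_fun (bdry M : set (borel X)) (fun p => complex.Re (a p)) /\
  measurable_fun (bdry M : set (borel X)) (fun p => complex.Im (a p)).
Proof.
by move=> [s1 s2]; split; apply: continuous_within_measurable;
  apply: smooth_along_continuous; [exact: s1|exact: s2].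
Qed.

Lemma bdry_coords (i : chart M) z : coords i (bdry M) z ->
  lastc z = 0 /\ bdry M (psi M i z).
Proof. by move=> [p [ip bp] <-]; rewrite phiK// (bdry_lastc hx). Qed.

(** Serves to pass smoothness from [v_+], defined on all of [X], to [S(lambda) a], which is
    prescribed at boundary points only. *)
Lemma csmooth_bdry_eq (a b : X -> R[i]) : (forall p, bdry M p -> a p = b p) ->
  csmooth_along M setT a -> csmooth_along M (bdry M) b.
Proof.
move=> ab [s1 s2].
by split=> i; [apply: eq_smooth_on (smooth_on_subset _ (s1 i))
              |apply: eq_smooth_on (smooth_on_subset _ (s2 i))];
  [move=> z /bdry_coords[_ /ab] /= ->|move=> z [p [ip _] <-]; exists p
  |move=> z /bdry_coords[_ /ab] /= ->|move=> z [p [ip _] <-]; exists p].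
Qed.

(* In a chart the slice is the restriction to t = 0 of the translate
   (y, t) |-> k (f (y, t + lam)), which is smooth in a neighbourhood. *)
Lemma smooth_slice (f : borel X * measurableTypeR R -> R[i]) (k : R[i] -> R) lam :
  0 < lam ->
  (forall i : chart M,
     smooth_on [set z | coords i (bdry M) (snoc (initc z) 0) /\ 0 < lastc z]
       (fun z => k (f (psi M i (snoc (initc z) 0), lastc z)))) ->
  smooth_along M (bdry M) (fun p => k (f (p, lam))).
Proof.
move=> lam0 sf i z bz; pose c := snoc (0 : 'rV[R]_m) lam.
(* Boundary coordinates end in 0, so translating by [c] changes the last coordinate to [lam] and
   keeps the boundary point. *)
have back w : coords i (bdry M) w ->
    snoc (initc (w + c)) 0 = w /\ lastc (w + c) = lam.
  move=> /bdry_coords[w0 _]; rewrite initc_vshift lastc_vshift w0 add0r.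
  by split=> //; rewrite -[RHS]snocK w0.
have [zi zl] := back _ bz.
have [|U [F [oU Uz cF Ff]]] := sf i (z + c); first by split; rewrite ?zi ?zl.
exists [set w | U (w + c)], (fun w => F (w + c)); split=> //.
- apply: (@open_comp _ _ (fun w : 'rV[R]_m.+1 => w + c)) => // w _.
  exact: continuous_shift.
- exact: Cinfty_shift.
- move=> w bw Uw; have [wi wl] := back _ bw.
  by rewrite Ff//= ?wi ?wl.
Qed.

Lemma test_csmooth_slice (dh : {finite_measure set (borel X) -> \bar R})
    (f : borel X * measurableTypeR R -> R[i]) lam :
  0 < lam -> test_bdryR M dh f -> csmooth_along M (bdry M) (fun p => f (p, lam)).
Proof. by move=> l0 [_ s1 s2 _]; split; exact: smooth_slice. Qed.

End BoundaryData.

Lemma eq_inner_l {R : realType} {d} {T : measurableType d}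
    (mu : {measure set T -> \bar R}) (D : set T) (f g h : T -> R[i]) :
  (forall t, D t -> f t = g t) -> inner mu D f h = inner mu D g h.
Proof.
by move=> fg; congr Complex; apply: eq_Rintegral => t /set_mem /fg ->.
Qed.

(** * The identity [P(lambda) = P(-lambda) S(lambda)] and its dual *)

Section PoissonIdentity.
Context {R : realType} {m : nat} {X : ptopologicalType} (M : manifold R m X).
Context (x : X -> R) (hx : boundary_defining M x) (g : cotensor2 M) (V : X -> R).
Context (dg : {measure set (borel X) -> \bar R}).
Context (dh : {finite_measure set (borel X) -> \bar R}).
Context (P S Pa : R -> (X -> R[i]) -> (X -> R[i])).
Hypothesis hP : poisson_operator x g V dg P.
Hypothesis hS : scattering_matrix x g V dg P S.
Hypothesis hPa : poisson_adjoint M dg dh P Pa.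

(** The equation depends on [lam ^+ 2] only, and the two exponentials are exchanged by the change of
    sign. *)
Lemma gen_eigen_opp lam u vm vp :
  gen_eigen x g V dg lam u vm vp -> gen_eigen x g V dg (- lam) u vp vm.
Proof.
move=> [sm sp eu uE]; split=> //; first by move=> w /eu; rewrite sqrrN.
by move=> p /uE ->; rewrite /= mulNr opprK addrC.
Qed.

Lemma scattering_csmooth lam a : lam != 0 -> csmooth_along M (bdry M) a ->
  csmooth_along M (bdry M) (S lam a).
Proof.
move=> l0 /(hS l0)[vm [vp [[_ sp _ _] _ vpS]]].
exact: (csmooth_bdry_eq hx vpS).
Qed.

Lemma poisson_scattering lam a : lam != 0 -> csmooth_along M (bdry M) a ->
  forall p, inter M p -> P lam a p = P (- lam) (S lam a) p.
Proof.
move=> l0 sa; have [vm [vp [ge vma vpS]]] := hS l0 sa.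
have Nl0 : - lam != 0 by rewrite oppr_eq0.
(* At energy parameter [- lam] the leading coefficient is [vp], whose boundary value is
   [S lam a]. *)
by have [_] := hP Nl0 (scattering_csmooth l0 sa); apply;
  exists vp, vm; split=> //; exact: gen_eigen_opp.
Qed.

(** Both sides are moved to the interior by the adjoint relation, where they pair [w] with the same
    function. *)
Lemma inner_scattering lam a w : lam != 0 -> csmooth_along M (bdry M) a ->
  Cdot M w ->
  inner dh (bdry M) (S lam a) (Pa (- lam) w) = inner dh (bdry M) a (Pa lam w).
Proof.
move=> l0 sa cw; have Nl0 : - lam != 0 by rewrite oppr_eq0.
rewrite -(hPa l0 cw).2// -(hPa Nl0 cw).2; last exact: scattering_csmooth.
by symmetry; apply: eq_inner_l; exact: poisson_scattering.
Qed.

End PoissonIdentity.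

(** * Fubini: almost every slice at a fixed second variable *)

Section Slices.
Context {R : realType} {d1 d2 : measure_display}.
Context {T1 : measurableType d1} {T2 : measurableType d2}.
Context (m1 : {sigma_finite_measure set T1 -> \bar R}).
Context (m2 : {sigma_finite_measure set T2 -> \bar R}).

(** By Tonelli the measures of the sections of a null set integrate to 0, so almost all of these
    sections are null. *)
Lemma ae_slice (Q : set (T1 * T2)) : {ae (m1 \x m2)%E, forall q, Q q} ->
  {ae m2, forall y, {ae m1, forall x, Q (x, y)}}.
Proof.
move=> [N [mN N0 QN]].
have mI : measurable_fun setT (EFin \o (\1_N : T1 * T2 -> R)).
  exact/measurable_EFinP/measurable_indic.
have I0 z : (0 <= (EFin \o (\1_N : T1 * T2 -> R)) z)%E by rewrite lee_fin.
have G0 : (\int[m2]_y fubini_G m1 (EFin \o (\1_N : T1 * T2 -> R)) y = 0)%E.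
  rewrite -(fubini_tonelli2 _ mI I0) integral_indic// setIT; exact: N0.
have mG := measurable_fun_fubini_tonelli_G _ mI I0 (m1 := m1).
have : ae_eq m2 setT (fubini_G m1 (EFin \o (\1_N : T1 * T2 -> R))) (cst 0%E).
  apply/(ae_eq_integral_abs _ measurableT mG); rewrite -[RHS]G0.
  apply: eq_integral => y _; rewrite gee0_abs//.
  by apply: integral_ge0 => z _; exact: I0.
apply: filterS => y /(_ I); rewrite indic_fubini_tonelli_GE// => Ny.
exists (ysection N y); split=> //; first exact: measurable_ysection.
by move=> z nQ; rewrite /ysection/= inE; exact: QN.
Qed.

Lemma eq_integral_slices (f g : T1 * T2 -> R) :
  (m1 \x m2)%E.-integrable setT (EFin \o f) ->
  (m1 \x m2)%E.-integrable setT (EFin \o g) ->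
  {ae m2, forall y, Rintegral m1 setT (fun x => f (x, y)) =
                    Rintegral m1 setT (fun x => g (x, y))} ->
  Rintegral (m1 \x m2)%E setT f = Rintegral (m1 \x m2)%E setT g.
Proof.
move=> fi gi fg; rewrite /Rintegral; congr fine.
rewrite -(integral21_prod_meas1 fi) -(integral21_prod_meas1 gi).
apply: ae_eq_integral => //.
- exact: (@measurable_fubini_G _ _ _ _ _ m1 m2).
- exact: (@measurable_fubini_G _ _ _ _ _ m1 m2).
move: (ae_integrable2 fi) (ae_integrable2 gi) fg.
apply: filterS3 => y fy gy fgy _.
(* [Rintegral] determines the extended integral only where the latter is finite; integrability of
   almost every slice guarantees this. *)
rewrite /fubini_G -[LHS]fineK ?integrable_fin_num// -[RHS]fineK ?integrable_fin_num//.
by congr EFin.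
Qed.

End Slices.

(** * Extension of identities by density *)

Section Density.
Context {R : realType} {d : measure_display} {T : measurableType d}.
Context (mu : {measure set T -> \bar R}) (D : set T) (mD : measurable D).

(** Each pairing is continuous in its left argument; [a] and [b] must be approximated together, by
    pairs for which the identity is known. *)
Lemma rinner_eq_of_dense (a b c e : T -> R[i]) :
  L2 mu D a -> L2 mu D b -> L2 mu D c -> L2 mu D e ->
  (forall r : R, 0 < r -> exists a' b', [/\ L2 mu D a' /\ L2 mu D b',
     (distsq mu D a' a < r%:E)%E, (distsq mu D b' b < r%:E)%E &
     rinner mu D a' c = rinner mu D b' e]) ->
  rinner mu D a c = rinner mu D b e.
Proof.
move=> La Lb Lc Le dense; apply/eqP; rewrite -subr_eq0 -normr_le0.
apply/ler_addgt0Pl => t t0; rewrite addr0.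
have t20 : 0 < t / 2 by rewrite divr_gt0.
have [r1 r10 h1] := rinner_continuous mD Lc t20.
have [r2 r20 h2] := rinner_continuous mD Le t20.
have r0 : 0 < Num.min r1 r2 by rewrite lt_min r10.
have [a' [b' [[La' Lb'] da db ab]]] := dense _ r0.
have lt1 : `|rinner mu D a' c - rinner mu D a c| < t / 2.
  rewrite !(rinnerC mu D _ c); apply: h1 => //; apply: lt_le_trans da _.
  by rewrite lee_fin ge_min lexx.
have lt2 : `|rinner mu D b' e - rinner mu D b e| < t / 2.
  rewrite !(rinnerC mu D _ e); apply: h2 => //; apply: lt_le_trans db _.
  by rewrite lee_fin ge_min lexx orbT.
move: lt1 lt2; rewrite ab !ltr_norml ler_norml => /andP[? ?] /andP[? ?].
by apply/andP; split; lra.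
Qed.

End Density.

Section Isometry.
Context {R : realType} {d1 d2 : measure_display}.
Context {T1 : measurableType d1} {T2 : measurableType d2}.
Context (mu1 : {measure set T1 -> \bar R}) (D1 : set T1).
Context (mu2 : {measure set T2 -> \bar R}) (D2 : set T2).
Hypotheses (mD1 : measurable D1) (mD2 : measurable D2).

(** The squared distance expands into inner products, which [U] preserves. An approximation found in
    [K] thereby becomes one of its transform. *)
Lemma unitary_distsq (K : set (T1 -> R[i])) U u v :
  (forall w, K w -> L2 mu1 D1 w) -> unitary_onto_L2 mu1 D1 mu2 D2 K U ->
  K u -> K v -> distsq mu2 D2 (U u) (U v) = distsq mu1 D1 u v.
Proof.
move=> KL2 [UL2 _ Ui _] Ku Kv.
have iso w z : K w -> K z -> rinner mu2 D2 (U w) (U z) = rinner mu1 D1 w z.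
  by move=> Kw Kz; rewrite /rinner Ui.
by rewrite !distsqE ?iso//; [exact: KL2|exact: KL2|exact: UL2|exact: UL2].
Qed.

End Isometry.

(** * Square integrability and slice pairings on the boundary *)

Section BoundaryPairing.
Context {R : realType} {m : nat} {X : ptopologicalType} (M : manifold R m X).
Context (x : X -> R) (hx : boundary_defining M x).
Context (dh : {finite_measure set (borel X) -> \bar R}).
Local Notation dB := (dhdlam dh).
Local Notation B := (bdryR M).
Local Notation mB := (measurable_bdryR hx).

(** The boundary is closed in a compact space, so [|a|^2] is bounded on it, and [dh] is finite. *)
Lemma csmooth_bdry_L2 (a : X -> R[i]) :
  csmooth_along M (bdry M) a -> L2 dh (bdry M) a.
Proof.
move=> sa; have [m1 m2] := csmooth_bdry_measurable sa.
have [/smooth_along_continuous c1 /smooth_along_continuous c2] := sa.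
have cn : {within bdry M, continuous (fun p => normsq (a p))}.
  move=> p; rewrite /normsq; under eq_fun do rewrite !expr2.
  exact: (cvgD (cvgM (c1 p) (c1 p)) (cvgM (c2 p) (c2 p))).
split=> //; apply: integrable_lty => //; first exact: measurable_bdry hx.
apply: measurable_bounded_integrable.
- exact: measurable_bdry hx.
- by rewrite -ge0_fin_numE// fin_num_measure//; exact: measurable_bdry hx.
- exact: continuous_within_measurable.
have cb : compact (bdry M).
  apply: (subclosed_compact _ (mf_compact M)) => //.
  rewrite -[bdry M]setCK; apply: open_closedC; exact: inter_open hx.
have := compact_bounded (continuous_compact cn cb).
by move=> [N [Nr h]]; exists N; split=> // r /h hr p bp; apply: hr; exists p.
Qed.

(** Extending the integrand by 0 outside [B] allows Fubini on the full product; the slice at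
    [lam > 0] is then the integrand on the boundary, extended by 0. Almost everywhere equality is
    all that [ae_slice] provides for [F] and [G]. *)
Lemma Rintegral_slice (F G : borel X * measurableTypeR R -> R[i])
    (f g : X -> R[i]) (c lam : R) :
  0 < lam -> L2 dB B F -> L2 dB B G ->
  csmooth_along M (bdry M) f -> csmooth_along M (bdry M) g ->
  {ae dh, forall p, B (p, lam) -> F (p, lam) = f p} ->
  {ae dh, forall p, B (p, lam) -> G (p, lam) = (c +i* 0)%C * g p} ->
  Rintegral dh setT (fun p => ((fun q => rdot (F q) (G q)) \_ B) (p, lam)) =
    c * rinner dh (bdry M) f g.
Proof.
move=> l0 LF LG sf sg Ff Gg; have mb := measurable_bdry hx.
have [Lf Lg] := (csmooth_bdry_L2 sf, csmooth_bdry_L2 sg).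
rewrite rinnerE -RintegralZl//; last exact: (integrable_rdot mb).
rewrite [RHS]Rintegral_mkcond; congr fine; apply: ae_eq_integral => //.
- apply/measurable_EFinP.
  apply: (measurableT_comp (f := (fun q => rdot (F q) (G q)) \_ B)).
    apply/(measurable_restrictT _ mB).
    exact: (measurable_rdot LF LG).
  exact: pair2_measurable.
- apply/measurable_EFinP/(measurable_restrictT _ mb).
  by apply: measurable_funM; [exact: measurable_cst|exact: (measurable_rdot Lf Lg)].
move: Ff Gg; apply: filterS2 => p Ff Gg _; congr EFin; rewrite !patchE.
have [bp|nbp] := pselect (bdry M p); last first.
  by rewrite !memNset// => -[].
have Bp : B (p, lam) by [].
rewrite !mem_set// Ff// Gg//.
by case: (f p) (g p) => u v [u' v']; rewrite /rdot /=; ring.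
Qed.

End BoundaryPairing.

(** * The pairing identity for test functions and [Cdot] *)

Section TestPairing.
Context {R : realType} {m : nat} {X : ptopologicalType} (M : manifold R m X).
Context (x : X -> R) (hx : boundary_defining M x) (g : cotensor2 M) (V : X -> R).
Context (dg : {measure set (borel X) -> \bar R}).
Context (dh : {finite_measure set (borel X) -> \bar R}).
Context (P S Pa : R -> (X -> R[i]) -> (X -> R[i])).
Hypothesis hP : poisson_operator x g V dg P.
Hypothesis hS : scattering_matrix x g V dg P S.
Hypothesis hPa : poisson_adjoint M dg dh P Pa.
Local Notation dB := (dhdlam dh).
Local Notation B := (bdryR M).

Lemma integrable_rdot_patch F G : L2 dB B F -> L2 dB B G ->
  dB.-integrable setT (EFin \o ((fun q => rdot (F q) (G q)) \_ B)).
Proof.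
move=> LF LG; have mB := measurable_bdryR hx.
rewrite -restrict_EFin; apply/(integrable_mkcond _ mB).
exact: (integrable_rdot mB LF LG).
Qed.

(* The factor [c] is the normalization (2 pi)^(-1/2) of the transforms. *)
Lemma test_pairing v w Sv Qp Qm (c : R) :
  test_bdryR M dh v -> Cdot M w ->
  L2 dB B Sv -> L2 dB B Qp -> L2 dB B Qm ->
  ae_eqon dB B Sv (fiberwise S v) ->
  ae_eqon dB B Qp (fun q => (c +i* 0)%C * Pa (1 * q.2) w q.1) ->
  ae_eqon dB B Qm (fun q => (c +i* 0)%C * Pa (-1 * q.2) w q.1) ->
  rinner dB B Sv Qm = rinner dB B v Qp.
Proof.
move=> tv cw LS Lp Lm Sve Qpe Qme; have [Lv _ _ _] := tv.
rewrite !rinnerE !(Rintegral_mkcond _ B).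
apply: eq_integral_slices; [exact: integrable_rdot_patch..|].
move: (ae_slice Sve) (ae_slice Qpe) (ae_slice Qme).
apply: filterS3 => lam Svl Qpl Qml.
(* For [lam <= 0] the slice misses [B], and both integrands are 0. *)
have [lam0|lam0] := leP lam 0.
  apply: eq_Rintegral => p _; rewrite !patchE memNset//.
  by move=> -[_] /=; rewrite ltNge lam0.
have l0 : lam != 0 by rewrite gt_eqF.
have Nl0 : - lam != 0 by rewrite oppr_eq0.
have sv := test_csmooth_slice hx lam0 tv.
have sS := scattering_csmooth hx hS l0 sv.
rewrite (Rintegral_slice (c := c) hx lam0 LS Lm sS (hPa Nl0 cw).1 Svl); last first.
  by apply: filterS Qml => p h /h ->; rewrite /= mulN1r.
rewrite (Rintegral_slice (c := c) hx lam0 Lv Lp sv (hPa l0 cw).1 _); first last.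
- by apply: filterS Qpl => p h /h ->; rewrite /= mul1r.
- by apply: aeW.
(* Both sides now carry the same factor [c], in front of the two pairings of [inner_scattering]. *)
by rewrite /rinner (inner_scattering hx hP hS hPa).
Qed.

End TestPairing.

(** * Density arguments and conclusion *)

Unset Implicit Arguments.

Theorem proposition9p2 (R : realType) (m : nat) (X : ptopologicalType)
  (M : manifold R m X)
  (x : X -> R) (hx : boundary_defining M x)
  (g h' : cotensor2 M) (hg : scattering_metric x g h')
  (V : X -> R) (hV : in_x2Cinfty M x V)
  (dg : {measure set (borel X) -> \bar R}) (hdg : volume_measure g dg)
  (dh : {finite_measure set (borel X) -> \bar R}) (hdh : bdry_measure h' dh)
  (P S Pa : R -> (X -> R[i]) -> (X -> R[i]))
  (hP : poisson_operator x g V dg P)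
  (hS : scattering_matrix x g V dg P S)
  (hPa : poisson_adjoint M dg dh P Pa)
  (E : set (measurableTypeR R) -> (borel X -> R[i]) -> (borel X -> R[i]))
  (hE : spectral_resolution dg (inter M) (H_graph g V dg) E)
  (Pstar_plus Pstar_minus :
     (borel X -> R[i]) -> (borel X * measurableTypeR R -> R[i]))
  (hPstar_plus : spectral_transform M dg dh 1 E Pa Pstar_plus)
  (hPstar_minus : spectral_transform M dg dh (-1) E Pa Pstar_minus)
  (P_plus : (borel X * measurableTypeR R -> R[i]) -> (borel X -> R[i]))
  (hP_plus : adjoint_into dg (inter M) (dhdlam dh) (bdryR M)
     (ac_subspace dg (inter M) E) Pstar_plus P_plus)
  (SS : (borel X * measurableTypeR R -> R[i]) ->
        (borel X * measurableTypeR R -> R[i]))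
  (hSS : scattering_operator M dh S SS) :
  forall f, L2 (dhdlam dh) (bdryR M) f ->
    ae_eqon (dhdlam dh) (bdryR M) (SS f) (Pstar_minus (P_plus f)).
Proof.
have mI := measurable_inter hx; have mB := measurable_bdryR hx.
have [Up [Qp2 Qp_Cdot Qp_dense]] := hPstar_plus.
have [Um [Qm2 Qm_Cdot _]] := hPstar_minus.
have [SS2 SS_test SS_dense] := hSS.
set K := ac_subspace dg (inter M) E in Up Um Qp2 Qm2 Qp_Cdot Qm_Cdot Qp_dense hP_plus.
have KL2 u : K u -> L2 dg (inter M) u by case.
have pair_test v u : test_bdryR M dh v -> K u ->
    rinner (dhdlam dh) (bdryR M) (SS v) (Pstar_minus u) =
    rinner (dhdlam dh) (bdryR M) v (Pstar_plus u).
  move=> tv Ku; have [Lv _ _ _] := tv.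
  (* The test function stays fixed while [u] is approximated, so the transforms of [u] are brought
     to the left slot. *)
  rewrite rinnerC [RHS]rinnerC.
  apply: (rinner_eq_of_dense mB) => //; [exact: Qm2|exact: Qp2|exact: SS2|].
  (* The same [w] serves both transforms: [dQ] controls [Pstar_plus w], and isometry carries [dw]
     over to [Pstar_minus w]. *)
  move=> r r0; have [w [cw Kw dw dQ]] := Qp_dense _ _ Ku r0.
  exists (Pstar_minus w), (Pstar_plus w); split=> //.
  - by split; [exact: Qm2|exact: Qp2].
  - by rewrite (unitary_distsq mI mB KL2 Um).
  rewrite rinnerC [RHS]rinnerC.
  by apply: (test_pairing hx hP hS hPa tv cw);
    [exact: SS2|exact: Qp2|exact: Qm2|exact: SS_test|exact: Qp_Cdot|exact: Qm_Cdot].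
have pair f u : L2 (dhdlam dh) (bdryR M) f -> K u ->
    rinner (dhdlam dh) (bdryR M) (SS f) (Pstar_minus u) =
    rinner (dhdlam dh) (bdryR M) f (Pstar_plus u).
  move=> Lf Ku; apply: (rinner_eq_of_dense mB) => //;
    [exact: SS2|exact: Qm2|exact: Qp2|].
  (* Now [u] is fixed and [f] varies; the extension by continuity gives [v] near [f] with [SS v]
     near [SS f]. *)
  move=> r r0; have [v [tv Lv dv dS]] := SS_dense _ _ Lf r0.
  by exists (SS v), v; split; [split=> //; exact: SS2|..|exact: pair_test].
move=> f Lf; have [Kw adj] := hP_plus _ Lf.
have [L1 L2m] := (SS2 _ Lf, Qm2 _ Kw); have L12 := L2B mB L1 L2m.
have [_ _ Um_iso Um_onto] := Um.
(* Surjectivity writes the difference of the two sides as [Pstar_minus u], so its squared norm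
   becomes a pairing with [Pstar_minus u]. *)
have [u [Ku Qu]] := Um_onto _ L12.
apply: (rinner_definite mB L1 L2m).
rewrite -(rinner_ae_eqr mB (Qm2 _ Ku) L12 L12 Qu) (rinnerBl mB L1 L2m (Qm2 _ Ku)).
(* Against [Pstar_minus u] both terms give the pairing of [f] with [Pstar_plus u]: the first by
   [pair], the second by isometry and then adjointness. *)
by rewrite pair// /rinner Um_iso// adj// subrr.
Qed.
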